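(* Consider a jump process on a finite state space $S$ with generator $Lf(x)=\int(f(y)-f(x))\,q(x,dy)$ and an invariant probability measure $\mu$. Let $\gamma:=\inf_{f\in L^2_0(\mu)\setminus\{0\}}\|Lf\|/\|f\|$ be its singular-value gap. Assume $\gamma>0$, that $$\mu_{\min}:=\min_{x\in S}\mu(x)>0,$$ and that the jump rates are bounded by $q_{\max}$, i.e. $q(x,S)\le q_{\max}$ for all $x\in S$. Then, for $\varepsilon\in(0,1/2)$, $$t_{\mathrm{mix}}(\varepsilon)\le\frac{2q_{\max}}{\gamma^2}\log\left(\frac{1}{2\varepsilon\sqrt{\mu_{\min}}}\right).$$
   Context: The jump kernel $q(x,\cdot)$ is a finite (nonnegative) measure on $S$ for each $x\in S$, with $q(x,S)$ the jump rate at $x$. $L^2(\mu)$ is the space of complex-valued functions on $S$ with $\langle f,g\rangle=\int\bar f g\,d\mu$ and norm $\|\cdot\|$; $L^2_0(\mu)=\{g:\int g\,d\mu=0\}$. The semigroup is $P_t=e^{tL}$, and $\mu$ is invariant ($\int Lh\,d\mu=0$ for all $h$). With $\|\nu-\mu\|_{\mathrm{TV}}=\sup_A|\nu(A)-\mu(A)|$, set $d(t)=\sup_{x\in S}\|P_t(x,\cdot)-\mu\|_{\mathrm{TV}}$ and $t_{\mathrm{mix}}(\varepsilon)=\inf\{t\ge0:d(t)\le\varepsilon\}$. Convention: $\inf\emptyset=+\infty$, $1/\infty=0$ (relevant only when $S$ is a single point). *)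

(* Defs.v *)
From HB Require Import structures.
From mathcomp Require Import all_boot all_order all_algebra.
From mathcomp Require Import all_classical all_reals all_analysis.
From mathcomp Require Export complex.

Set Implicit Arguments.
Unset Strict Implicit.
Unset Printing Implicit Defensive.

Import Order.TTheory GRing.Theory Num.Theory.
Import numFieldNormedType.Exports.

Local Open Scope classical_set_scope.
Local Open Scope ring_scope.

(* A measure on the finite set [S] is given by its point masses [m : S -> R].
   Functions take values in an [R]-module [V]: complex-valued functions use
   [V := Rcomplex R], which is [R[i]] regarded as a module over [R], and
   real-valued ones use [V := R^o]. *)
Definition mass (R : realType) (S : finType) (m : S -> R) (A : {set S}) : R :=
  \sum_(x in A) m x.

Definition fin_integral (R : realType) (S : finType) (V : lmodType R)
    (m : S -> R) (g : S -> V) : V :=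
  \sum_(x : S) m x *: g x.

Definition is_probability (R : realType) (S : finType) (m : S -> R) : Prop :=
  (forall x, 0 <= m x) /\ mass m [set: S]%SET = 1.

Definition generator (R : realType) (S : finType) (V : lmodType R)
    (q : S -> S -> R) (f : S -> V) : S -> V :=
  fun x => fin_integral (q x) (fun y => f y - f x).

Definition invariant_measure (R : realType) (S : finType)
    (q : S -> S -> R) (mu : S -> R) : Prop :=
  forall h : S -> Rcomplex R, fin_integral mu (generator q h) = 0.

Definition L2_inner (R : realType) (S : finType) (mu : S -> R)
    (f g : S -> Rcomplex R) : Rcomplex R :=
  fin_integral mu (fun x => conjc (f x) * g x : Rcomplex R).

Definition L2_norm (R : realType) (S : finType) (mu : S -> R)
    (f : S -> Rcomplex R) : R :=
  Num.sqrt (complex.Re (L2_inner mu f f)).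

(* [L2_norm mu f != 0] says that [f] is nonzero as an element of [L^2(mu)].
   The infimum is taken in the extended reals, hence is [+oo] when there is no
   such [f], i.e. when [L^2_0(mu)] is trivial. *)
Definition singular_gap (R : realType) (S : finType)
    (q : S -> S -> R) (mu : S -> R) : \bar R :=
  ereal_inf [set (L2_norm mu (generator q f) / L2_norm mu f)%:E |
    f in [set f : S -> Rcomplex R |
            fin_integral mu f = 0 /\ L2_norm mu f != 0]].

(* e^{tL} f, as the pointwise sum of the exponential series
   \sum_n (t^n / n!) L^n f. *)
Definition semigroup (R : realType) (S : finType) (q : S -> S -> R) (t : R)
    (f : S -> R^o) : S -> R :=
  fun x => limn (series (fun n => exp_coeff t n * iter n (generator q) f x : R)).

Definition transition (R : realType) (S : finType) (q : S -> S -> R) (t : R)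
    (x : S) (A : {set S}) : R :=
  semigroup q t (fun y => (y \in A)%:R) x.

Definition tv_dist (R : realType) (S : finType) (nu mu : {set S} -> R) : R :=
  sup (range (fun A : {set S} => `|nu A - mu A|)).

Definition max_tv_dist (R : realType) (S : finType) (q : S -> S -> R)
    (mu : S -> R) (t : R) : R :=
  sup (range (fun x : S => tv_dist (transition q t x) (mass mu))).

Definition t_mix (R : realType) (S : finType) (q : S -> S -> R) (mu : S -> R)
    (eps : R) : \bar R :=
  ereal_inf [set t%:E | t in [set t : R | 0 <= t /\ max_tv_dist q mu t <= eps]].

Definition mu_min (R : realType) (S : finType) (mu : S -> R) : R :=
  inf (range mu).

(* Main.v *)
Require Import Defs.
From HB Require Import structures.
From mathcomp Require Import all_boot all_order all_algebra.
From mathcomp Require Import all_classical all_reals all_analysis.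
From mathcomp Require Import ring lra.

(** The chain need not be reversible, so the singular-value gap [gamma] cannot be
    read directly as a spectral gap. It still yields a Poincare inequality,
    because [||L g||^2] is controlled by the Dirichlet form: Cauchy-Schwarz in
    the jump kernel gives
      [|L g(x)|^2 <= qmax * \sum_y q x y * (g y - g x)^2],
    and integrating against the invariant measure turns the right-hand side into
    [-2 qmax <g, L g>] ([dirichlet_form]). Hence for [g] of mean zero
      [gamma^2 ||g||^2 <= ||L g||^2 <= -2 qmax <g, L g>] ([gap_sqr_le]).

    Along [u_t = P_t f - mu(f)], which stays of mean zero and solves
    [u' = L u], the derivative of [||u_t||^2] is [2 <u_t, L u_t>], which is at
    most [-(gamma^2 / qmax) ||u_t||^2]. A Gronwall argument then gives
    [||u_t||^2 <= exp (- gamma^2 t / qmax) ||u_0||^2] ([variance_decay]).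

    Total variation is reached by taking [f] to be the indicator of a set [A]:
    then [u_t x = P_t(x, A) - mu(A)] and [||u_0||^2 = mu(A) (1 - mu(A)) <= 1/4],
    while a single point carries mass at least [mu_min], so
    [mu_min * |u_t x|^2 <= ||u_t||^2]. Hence [|u_t x|] is
    at most [eps] as soon as [exp (- gamma^2 t / qmax) <= 4 eps^2 mu_min], which
    is the announced time.

    The semigroup is a power series in [t], whose convergence and termwise
    differentiation follow from the bound [|L^n f| <= (2 qmax)^n sup |f|]. *)

Import Order.TTheory GRing.Theory Num.Theory.
Import numFieldNormedType.Exports.

Set Implicit Arguments.
Unset Strict Implicit.
Unset Printing Implicit Defensive.

Local Open Scope ring_scope.

(** * The exponential series of the generator *)

Lemma generatorE (R : realType) (S : finType) (q : S -> S -> R) (f : S -> R^o) x :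
  generator q f x = \sum_y q x y * (f y - f x).
Proof. by []. Qed.

Lemma iter_generator_bound (R : realType) (S : finType) (q : S -> S -> R)
    (Q B : R) (f : S -> R^o) :
  (forall x y, 0 <= q x y) -> (forall x, mass (q x) [set: S]%SET <= Q) ->
  (forall x, `|f x| <= B) ->
  forall n x, `|iter n (generator q) f x| <= (2 * Q) ^+ n * B.
Proof.
move=> q0 qQ fB n.
elim: n => [|n IH] x; first by rewrite expr0 mul1r.
rewrite iterS generatorE; apply: le_trans (ler_norm_sum _ _ _) _.
set g := iter n _ f in IH *; set C := _ ^+ n * B in IH.
have C0 : 0 <= C by exact: le_trans (IH x).
have -> : (2 * Q) ^+ n.+1 * B = Q * (2 * C) by rewrite /C exprS; ring.
apply: (@le_trans _ _ (\sum_y q x y * (2 * C))).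
  apply: ler_sum => y _; rewrite normrM (ger0_norm (q0 _ _)).
  apply: ler_wpM2l => //; apply: le_trans (ler_normB _ _) _.
  by have := IH x; have := IH y; lra.
rewrite -mulr_suml; apply: ler_wpM2r; first by rewrite mulr_ge0.
by have := qQ x; rewrite /mass; under eq_bigl do rewrite inE.
Qed.

(** The exponential series of [|t| * (2 * Q)] dominates, by
    [iter_generator_bound]. *)
Lemma cvg_semigroup (R : realType) (S : finType) (q : S -> S -> R)
    (Q : R) (f : S -> R^o) (t : R) (x : S) :
  (forall x y, 0 <= q x y) -> (forall x, mass (q x) [set: S]%SET <= Q) ->
  (series (fun n => exp_coeff t n * iter n (generator q) f x : R) @ \oo
     --> semigroup q t f x)%classic.
Proof.
move=> q0 qQ.
pose B : R := \sum_y `|f y|.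
have fB y : `|f y| <= B by rewrite /B (bigD1 y)//= lerDl sumr_ge0.
apply: normed_cvg.
apply: (@series_le_cvg _ _ (fun n => B * exp_coeff (`|t| * (2 * Q)) n)).
- by move=> n /=.
- move=> n; rewrite mulr_ge0 ?(le_trans _ (fB x))// exp_coeff_ge0//.
  rewrite mulr_ge0// mulr_ge0//; apply: le_trans (qQ x).
  by rewrite /mass sumr_ge0.
- move=> n; rewrite /= normrM /exp_coeff/= normrM normrX normfV.
  rewrite [`|_%:R|]ger0_norm// exprMn.
  have -> : B * (`|t| ^+ n * (2 * Q) ^+ n / n`!%:R) =
    `|t| ^+ n / n`!%:R * ((2 * Q) ^+ n * B) by ring.
  apply: ler_wpM2l; first by rewrite mulr_ge0// invr_ge0.
  exact: iter_generator_bound.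
- have := @is_cvg_seriesZ _ (exp_coeff (`|t| * (2 * Q))) B.
  by apply; exact: is_cvg_series_exp_coeff.
Qed.

(** [L] is a finite sum, so it passes through the limit of the partial sums; this
    turns the termwise derivative of [P_t f] into the equation [u' = L u]. *)
Lemma generator_semigroup (R : realType) (S : finType) (q : S -> S -> R)
    (Q : R) (f : S -> R^o) (t : R) (x : S) :
  (forall x y, 0 <= q x y) -> (forall x, mass (q x) [set: S]%SET <= Q) ->
  generator q (semigroup q t f : S -> R^o) x = semigroup q t (generator q f) x.
Proof.
move=> q0 qQ; apply/esym; rewrite {1}/semigroup generatorE.
apply/cvg_lim => //.
have c y := @cvg_semigroup R S q Q f t y q0 qQ.
rewrite (_ : series _ = fun n => \sum_y q x y *
   (series (fun n => exp_coeff t n * iter n (generator q) f y : R) n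
   - series (fun n => exp_coeff t n * iter n (generator q) f x : R) n)); last first.
  apply/funext => n; rewrite /series/=.
  under [RHS]eq_bigr do rewrite -sumrB mulr_sumr.
  rewrite exchange_big/=; apply: eq_bigr => i _.
  rewrite -iterSr iterS generatorE mulr_sumr; apply: eq_bigr => y _; ring.
apply: (cvg_big (op := +%R)) => [|y _]; first exact: add_continuous.
by apply: cvgMr; apply: cvgB.
Qed.

(** As a power series in [t], [P_t f x] has coefficients [L^n f x / n!]. Formal
    differentiation shifts them, which replaces [f] by [L f]; the convergence
    needed for termwise differentiation is thus again that of a semigroup
    series. *)
Lemma semigroup_derive (R : realType) (S : finType) (q : S -> S -> R)
    (Q : R) (f : S -> R^o) (t : R) (x : S) :
  (forall x y, 0 <= q x y) -> (forall x, mass (q x) [set: S]%SET <= Q) ->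
  is_derive t 1 (fun s => semigroup q s f x : R)
    (generator q (semigroup q t f : S -> R^o) x : R).
Proof.
move=> q0 qQ.
pose c f n : R := iter n (generator q) f x / n`!%:R.
have sc g s : series (fun n => exp_coeff s n * iter n (generator q) g x : R) =
    pseries (c g) s.
  rewrite /pseries; congr series; apply/funext => n.
  by rewrite /exp_coeff/= /c; ring.
have dc g : pseries_diffs (c g) = c (generator q g).
  apply/funext => n; rewrite /pseries_diffs /c -iterSr factS natrM.
  by rewrite invfM mulrCA mulVKf// pnatr_eq0.
have cc g s : cvgn (pseries (c g) s).
  rewrite -sc; apply/cvg_ex; exists (semigroup q s g x).
  exact: (@cvg_semigroup R S q Q g s x q0 qQ).
rewrite (@generator_semigroup R S q Q f t x q0 qQ) /semigroup sc.
under eq_fun do rewrite sc.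
rewrite -dc.
(* any point of modulus larger than [t] would do as the radius *)
by apply: (@pseries_snd_diffs _ (c f) (`|t| + 1)); rewrite ?dc //
  [ltRHS]ger0_norm ?ltrDl// addr_ge0.
Qed.

Lemma semigroup0 (R : realType) (S : finType) (q : S -> S -> R) (f : S -> R^o) x :
  semigroup q 0 f x = f x.
Proof.
apply/cvg_lim => //; rewrite -cvg_shiftS.
rewrite (_ : (fun _ => _) = fun=> f x); first exact: cvg_cst.
apply/funext => n; rewrite /series/= big_nat_recl//= big1 ?addr0.
  by rewrite /exp_coeff/= expr0 fact0 invr1 !mul1r.
by move=> i _; rewrite /exp_coeff/= expr0n/= mul0r mul0r.
Qed.

(** * The Poincare inequality *)

(** Weighted Cauchy-Schwarz: with [W] the total weight and [s] the weighted sum,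
    expand the nonnegative sum of the [w y * (W * d y - s) ^+ 2]; it equals [W]
    times the difference of the two sides. *)
Lemma sqr_sum_le (R : realType) (S : finType) (w d : S -> R) :
  (forall y, 0 <= w y) ->
  (\sum_y w y * d y) ^+ 2 <= (\sum_y w y) * \sum_y w y * d y ^+ 2.
Proof.
move=> w0; set s := \sum_y w y * d y; set W := \sum_y w y; set A := \sum_y _ * _ ^+ 2.
have W0 : 0 <= W by exact: sumr_ge0.
have [W00|Wn0] := eqVneq W 0.
  have w00 y : w y = 0 by apply: (psumr_eq0P (fun i _ => w0 i) W00).
  by rewrite W00 mul0r /s big1 ?expr0n// => y _; rewrite w00 mul0r.
have Wp : 0 < W by rewrite lt_neqAle eq_sym Wn0.
have : 0 <= \sum_y w y * (W * d y - s) ^+ 2.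
  by apply: sumr_ge0 => y _; rewrite mulr_ge0 ?sqr_ge0.
have expand a b : \sum_y w y * (b * d y - a) ^+ 2 =
    b ^+ 2 * (\sum_y w y * d y ^+ 2) - 2 * b * a * (\sum_y w y * d y)
      + a ^+ 2 * (\sum_y w y).
  rewrite !mulr_sumr -sumrB -big_split/=.
  by apply: eq_bigr => y _; ring.
rewrite expand -/A -/s -/W.
have -> : W ^+ 2 * A - 2 * W * s * s + s ^+ 2 * W = W * (W * A - s ^+ 2) by ring.
by rewrite pmulr_rge0// subr_ge0.
Qed.

(** The gap and invariance are stated for complex functions, whereas the argument
    runs with real ones; the next lemmas transfer them along the embedding of the
    reals in the complex numbers. *)
Lemma fin_integral_real (R : realType) (S : finType) (m : S -> R) (g : S -> R) :
  fin_integral m (fun x => (g x)%:C%C : Rcomplex R) = (\sum_x m x * g x)%:C%C.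
Proof.
rewrite /fin_integral rmorph_sum; apply: eq_bigr => x _ /=.
by apply/eqP; rewrite eq_complex/= mulr0 !eqxx.
Qed.

Lemma generator_real (R : realType) (S : finType) (q : S -> S -> R) (g : S -> R) :
  generator q (fun x => (g x)%:C%C : Rcomplex R) =
  fun x => (generator q (g : S -> R^o) x : R)%:C%C.
Proof.
apply/funext => x; rewrite generatorE -fin_integral_real /generator; congr fin_integral.
by apply/funext => y; rewrite rmorphB.
Qed.

Lemma L2_norm_real (R : realType) (S : finType) (mu : S -> R) (g : S -> R) :
  L2_norm mu (fun x => (g x)%:C%C : Rcomplex R) = Num.sqrt (\sum_x mu x * g x ^+ 2).
Proof.
rewrite /L2_norm /L2_inner.
rewrite (_ : (fun x => _) = fun x => (g x ^+ 2)%:C%C : Rcomplex R) ?fin_integral_real//.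
by apply/funext => x; rewrite conjc_real -rmorphM expr2.
Qed.

Lemma invariant_real (R : realType) (S : finType) (q : S -> S -> R) (mu : S -> R) :
  invariant_measure q mu -> forall g : S -> R^o, \sum_x mu x * generator q g x = 0 :> R.
Proof.
move=> inv g; have := inv (fun x => (g x)%:C%C).
by rewrite generator_real fin_integral_real => -[].
Qed.

(** Invariance applied to [g ^+ 2], with
    [g y ^+ 2 - g x ^+ 2 = (g y - g x) ^+ 2 + 2 * g x * (g y - g x)]. *)
Lemma dirichlet_form (R : realType) (S : finType) (q : S -> S -> R) (mu : S -> R) :
  invariant_measure q mu -> forall g : S -> R^o,
  \sum_x mu x * \sum_y q x y * (g y - g x) ^+ 2 =
  - 2 * \sum_x mu x * (g x * generator q g x) :> R.
Proof.
move=> inv g; have := invariant_real inv (fun x => g x ^+ 2 : R^o).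
rewrite (eq_bigr (fun x => mu x * (\sum_y q x y * (g y - g x) ^+ 2) +
   2 * (mu x * (g x * generator q g x)))); last first.
  move=> x _; rewrite !generatorE.
  transitivity (mu x * (\sum_y q x y * (g y - g x) ^+ 2 +
      2 * g x * (\sum_y q x y * (g y - g x)))); last by ring.
  congr (_ * _); rewrite mulr_sumr -big_split/=.
  by apply: eq_bigr => y _; ring.
by rewrite big_split/= -mulr_sumr => /eqP; rewrite addr_eq0 mulNr => /eqP.
Qed.

Lemma singular_gap_le (R : realType) (S : finType) (q : S -> S -> R)
    (mu : S -> R) (g : S -> R^o) :
  \sum_x mu x * g x = 0 :> R -> 0 < \sum_x mu x * g x ^+ 2 :> R ->
  (singular_gap q mu <= (Num.sqrt (\sum_x mu x * (generator q g x : R) ^+ 2) /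
     Num.sqrt (\sum_x mu x * (g x : R) ^+ 2))%:E)%E.
Proof.
move=> g0 gp; apply: ereal_inf_lbound.
exists (fun x => (g x)%:C%C).
  split=> /=; first by rewrite fin_integral_real g0.
  by rewrite L2_norm_real gt_eqF// sqrtr_gt0.
by rewrite generator_real !L2_norm_real.
Qed.

(** The right-hand side is [Q] times the Dirichlet form, which dominates
    [||L g||^2] by Cauchy-Schwarz in each kernel [q x]. The number [r] stands for
    the gap, which lives in the extended reals. *)
Lemma gap_sqr_le (R : realType) (S : finType) (q : S -> S -> R)
    (mu : S -> R) (Q r : R) (g : S -> R^o) :
  (forall x y, 0 <= q x y) -> (forall x, mass (q x) [set: S]%SET <= Q) ->
  (forall x, 0 <= mu x) -> invariant_measure q mu ->
  0 <= r -> (r%:E <= singular_gap q mu)%E ->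
  \sum_x mu x * g x = 0 :> R ->
  r ^+ 2 * \sum_x mu x * g x ^+ 2 <=
    - (2 * Q) * \sum_x mu x * (g x * generator q g x) :> R.
Proof.
move=> q0 qQ mu0 inv r0 rgap g0.
set A : R := \sum_x mu x * g x ^+ 2.
set B : R := \sum_x mu x * (generator q g x : R) ^+ 2.
have A0 : 0 <= A by apply: sumr_ge0 => x _; rewrite mulr_ge0 ?sqr_ge0.
have B0 : 0 <= B by apply: sumr_ge0 => x _; rewrite mulr_ge0 ?sqr_ge0.
apply: (@le_trans _ _ B).
  have [Ap|] := ltP 0 A; last first.
    by move=> A0'; rewrite (_ : A = 0) ?mulr0//; apply/eqP; rewrite eq_le A0 A0'.
  have := le_trans rgap (singular_gap_le q g0 Ap).
  rewrite lee_fin ler_pdivlMr ?sqrtr_gt0// => h.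
  rewrite -(sqr_sqrtr A0) -(sqr_sqrtr B0) -exprMn.
  by rewrite lerXn2r// nnegrE ?mulr_ge0 ?sqrtr_ge0.
have -> : - (2 * Q) * \sum_x mu x * (g x * generator q g x) =
  Q * \sum_x mu x * \sum_y q x y * (g y - g x) ^+ 2.
  by rewrite dirichlet_form//; ring.
rewrite mulr_sumr; apply: ler_sum => x _; rewrite [leRHS]mulrCA; apply: ler_wpM2l => //.
rewrite generatorE; apply: le_trans (sqr_sum_le _ (q0 x)) _.
apply: ler_wpM2r; first by apply: sumr_ge0 => y _; rewrite mulr_ge0 ?sqr_ge0.
by have := qQ x; rewrite /mass; under eq_bigl do rewrite inE.
Qed.

(** * Exponential decay of the variance *)

(** [expR (k * t) * phi t] is nonincreasing, its derivative being
    [expR (k * t) * (k * phi t + dphi t)], which is at most 0. *)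
Lemma gronwall_le (R : realType) (k : R) (phi dphi : R -> R) :
  (forall t : R, is_derive t 1 phi (dphi t)) -> (forall t, dphi t <= - k * phi t) ->
  forall t : R, 0 <= t -> phi t <= expR (- (k * t)) * phi 0.
Proof.
move=> dphiP h t t0.
pose psi (s : R) : R := expR (k * s) * phi s.
pose dpsi (s : R) : R := expR (k * s) * (k * phi s + dphi s).
have dpsiP (s : R) : is_derive s 1 psi (dpsi s).
  have := dphiP s => ?.
  apply: is_derive_eq; rewrite /dpsi /GRing.scale/= ; ring.
have cont : {within `[0, t], continuous psi}%classic.
  apply: continuous_subspaceT => s; apply: differentiable_continuous.
  by apply/derivable1_diffP; exact: (@ex_derive _ _ _ _ _ _ _ (dpsiP s)).
have [c _ e] := MVT_segment t0 (fun s _ => dpsiP s) cont.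
have : psi t <= psi 0.
  rewrite -subr_le0 e subr0 mulr_le0_ge0// /dpsi pmulr_rle0 ?expR_gt0//.
  by have := h c; lra.
by rewrite /psi mulr0 expR0 mul1r expRN ler_pdivlMl ?expR_gt0.
Qed.

Lemma is_derive_fin_sum (R : realType) (S : finType) (h : S -> R -> R)
    (dh : S -> R) (t : R) :
  (forall x, is_derive t 1 (h x) (dh x)) ->
  is_derive t 1 (fun s => \sum_x h x s) (\sum_x dh x).
Proof.
move=> dhP; rewrite -fct_sumE.
by elim/big_ind2 : _ => // [|] *; [exact: is_derive_cst|exact: is_deriveD].
Qed.

Lemma generator_subr_cst (R : realType) (S : finType) (q : S -> S -> R)
    (f : S -> R^o) (c : R) :
  generator q (fun x => f x - c : R^o) = generator q f.
Proof.
apply/funext => x; rewrite !generatorE; apply: eq_bigr => y _.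
by rewrite opprB addrA subrK.
Qed.

(** The derivative in [t] is the integral of [L (P_t f)], which vanishes by
    invariance. *)
Lemma semigroup_mean (R : realType) (S : finType) (q : S -> S -> R)
    (mu : S -> R) (Q : R) (f : S -> R^o) (t : R) :
  (forall x y, 0 <= q x y) -> (forall x, mass (q x) [set: S]%SET <= Q) ->
  invariant_measure q mu ->
  \sum_x mu x * semigroup q t f x = \sum_x mu x * f x.
Proof.
move=> q0 qQ inv.
transitivity (\sum_x mu x * semigroup q 0 f x); last first.
  by apply: eq_bigr => x _; rewrite semigroup0.
apply: (@is_derive_0_is_cst _ (fun s => \sum_x mu x * semigroup q s f x)) => s.
apply: is_derive_eq (invariant_real inv (semigroup q s f)).
apply: (@is_derive_fin_sum _ _ (fun x s => mu x * semigroup q s f x)) => x.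
have ? := @semigroup_derive R S q Q f s x q0 qQ.
by apply: is_derive_eq; rewrite /GRing.scale/=; ring.
Qed.

(** [L] kills constants, so [u = P_t f - m] solves [u' = L u]; its mean stays
    zero, so [gap_sqr_le] bounds the derivative of its squared norm. *)
Lemma variance_decay (R : realType) (S : finType) (q : S -> S -> R)
    (mu : S -> R) (Q r : R) (f : S -> R^o) (t : R) :
  (forall x y, 0 <= q x y) -> (forall x, mass (q x) [set: S]%SET <= Q) ->
  is_probability mu -> invariant_measure q mu ->
  0 < Q -> 0 <= r -> (r%:E <= singular_gap q mu)%E -> 0 <= t ->
  let m : R := \sum_x mu x * f x in
  \sum_x mu x * (semigroup q t f x - m) ^+ 2 <=
    expR (- (r ^+ 2 / Q * t)) * \sum_x mu x * (f x - m) ^+ 2.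
Proof.
move=> q0 qQ [mu0 mu1] inv Q0 r0 rgap t0; set m := \sum_x mu x * f x; lazy zeta.
pose u s x : R^o := semigroup q s f x - m.
pose phi s : R := \sum_x mu x * u s x ^+ 2.
pose dphi s : R := 2 * \sum_x mu x * (u s x * generator q (u s) x).
have mass1 : \sum_x mu x = 1.
  by rewrite -mu1 /mass; apply: eq_bigl => x; rewrite inE.
have -> : \sum_x mu x * (f x - m) ^+ 2 = phi 0.
  by apply: eq_bigr => x _; rewrite /u semigroup0.
apply: (@gronwall_le _ _ phi dphi) t0 => s.
  rewrite /dphi mulr_sumr; apply: is_derive_fin_sum => x.
  rewrite /u generator_subr_cst.
  have ? := @semigroup_derive R S q Q f s x q0 qQ.
  by apply: is_derive_eq; rewrite /GRing.scale/=; ring.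
have u0 : \sum_x mu x * u s x = 0 :> R.
  under eq_bigr do rewrite mulrBr.
  by rewrite sumrB -mulr_suml mass1 mul1r (semigroup_mean f s q0 qQ inv) subrr.
have := gap_sqr_le q0 qQ mu0 inv r0 rgap u0.
rewrite -/(phi s) => h.
rewrite mulNr lerNr mulrAC ler_pdivrMr//.
rewrite [leRHS](_ : _ =
  - (2 * Q) * \sum_x mu x * (u s x * generator q (u s) x))//.
by rewrite /dphi; ring.
Qed.

(** * From variance to total variation *)

Lemma mass_indicator (R : realType) (S : finType) (mu : S -> R) (A : {set S}) :
  mass mu A = \sum_x mu x * (x \in A)%:R.
Proof.
rewrite /mass big_mkcond/=; apply: eq_bigr => x _.
by case: (x \in A); rewrite ?mulr1 ?mulr0.
Qed.

(** The variance of an indicator of mean [m] is [m * (1 - m)]. The bound [1/4] is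
    the source of the [2] inside the logarithm of the mixing bound. *)
Lemma indicator_variance_le (R : realType) (S : finType) (mu : S -> R)
    (A : {set S}) :
  is_probability mu ->
  \sum_x mu x * ((x \in A)%:R - mass mu A) ^+ 2 <= 1 / 4.
Proof.
move=> [mu0 mu1]; set m := mass mu A.
have -> : \sum_x mu x * ((x \in A)%:R - m) ^+ 2 =
    m * (1 - 2 * m) + m ^+ 2 * mass mu [set: S]%SET.
  rewrite {2}/m !mass_indicator mulr_suml mulr_sumr -big_split/=.
  by apply: eq_bigr => x _; rewrite inE; case: (x \in A) => /=; ring.
rewrite mu1 -subr_ge0.
have -> : 1 / 4 - (m * (1 - 2 * m) + m ^+ 2 * 1) = (m - 1 / 2) ^+ 2 by field.
exact: sqr_ge0.
Qed.

Lemma mu_min_le (R : realType) (S : finType) (mu : S -> R) (x : S) :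
  is_probability mu -> mu_min mu <= mu x.
Proof.
move=> [mu0 _]; apply: ge_inf; last by exists x.
by exists 0 => _ [y _ <-].
Qed.

Lemma t_mix_le (R : realType) (S : finType) (q : S -> S -> R) (mu : S -> R)
    (eps t : R) (x0 : S) :
  0 <= t -> (forall x A, `|transition q t x A - mass mu A| <= eps) ->
  (t_mix q mu eps <= t%:E)%E.
Proof.
move=> t0 close; apply: ereal_inf_lbound; exists t => //; split=> //.
apply: ge_sup; first by eexists; exists x0.
move=> _ [x _ <-]; apply: ge_sup; first by eexists; exists [set: S]%SET.
by move=> _ [A _ <-].
Qed.

(** The atom at [x] alone contributes at least [mu_min mu] times the squared
    deviation at [x]. *)
Lemma transition_dist_le (R : realType) (S : finType) (q : S -> S -> R)
    (mu : S -> R) (eps t : R) (x : S) (A : {set S}) :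
  is_probability mu -> 0 < mu_min mu -> 0 <= eps ->
  \sum_y mu y * (transition q t y A - mass mu A) ^+ 2 <= mu_min mu * eps ^+ 2 ->
  `|transition q t x A - mass mu A| <= eps.
Proof.
move=> prob mm0 eps0 h.
have [mu0 _] := prob.
rewrite -ler_sqr ?nnegrE//.
rewrite real_normK ?num_real// -(ler_pM2l mm0).
apply: le_trans h; rewrite (bigD1 x)//=.
apply: (@le_trans _ _ (mu x * (transition q t x A - mass mu A) ^+ 2)).
  by rewrite ler_wpM2r ?sqr_ge0// mu_min_le.
by rewrite lerDl sumr_ge0// => y _; rewrite mulr_ge0 ?sqr_ge0.
Qed.

Theorem proposition5 (R : realType) (S : finType) (q : S -> S -> R)
    (mu : S -> R) (qmax eps : R)
    (q_ge0 : forall x y, 0 <= q x y)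
    (mu_prob : is_probability mu)
    (mu_inv : invariant_measure q mu)
    (gap_gt0 : (0 < singular_gap q mu)%E)
    (mu_min_gt0 : 0 < mu_min mu)
    (rate_le : forall x, mass (q x) [set: S]%SET <= qmax)
    (eps_gt0 : 0 < eps) (eps_lt : eps < 1 / 2) :
  (t_mix q mu eps <=
     (2 * qmax)%:E / (singular_gap q mu ^+ 2)
       * (ln (1 / (2 * eps * Num.sqrt (mu_min mu))))%:E)%E.
Proof.
have [mu0 mu1] := mu_prob.
have [x0 _] : exists x0 : S, True.
  case: (pickP (fun _ : S => true)) => [x0 _|S0]; first by exists x0.
  move: mu1; rewrite /mass big_pred0 => [/eqP|x].
    by rewrite eq_sym oner_eq0.
  by have := S0 x.
have qmax0 : 0 <= qmax by apply: le_trans (rate_le x0); exact: sumr_ge0.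
pose var (A : {set S}) : R := \sum_y mu y * ((y \in A)%:R - mass mu A) ^+ 2.
have meanA (A : {set S}) : \sum_y mu y * ((y \in A)%:R - mass mu A) = 0.
  under eq_bigr do rewrite mulrBr.
  rewrite sumrB -mass_indicator -mulr_suml.
  have -> : \sum_x mu x = 1 by rewrite -mu1; apply: eq_bigl => x; rewrite inE.
  by rewrite mul1r subrr.
(* If all indicators have zero variance, the chain is mixed at time 0. This
   covers an infinite gap, as well as [qmax = 0], where the rate
   [r ^+ 2 / qmax] of [variance_decay] is meaningless. *)
have degenerate : (forall A, var A <= 0) -> (t_mix q mu eps <= 0)%E.
  move=> v0; apply: (t_mix_le x0) => // x A.
  apply: transition_dist_le => //; first exact: ltW.
  rewrite /transition; under eq_bigr do rewrite semigroup0.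
  by apply: le_trans (v0 A) _; rewrite mulr_ge0 ?sqr_ge0// ltW.
case gapE : (singular_gap q mu) gap_gt0 => [r| |] // gap_gt0; last first.
  rewrite (_ : +oo ^+ 2 = +oo)%E// invey mule0 mul0e.
  apply: degenerate => A; rewrite leNgt; apply/negP => vA.
  by have := singular_gap_le q (meanA A) vA; rewrite gapE.
have r0 : 0 < r by rewrite -lte_fin.
have rgap : (r%:E <= singular_gap q mu)%E by rewrite gapE.
have r2 : 0 < r ^+ 2 by rewrite exprn_gt0.
rewrite -EFin_expe inver (gt_eqF r2) -!EFinM.
move: qmax0; rewrite le_eqVlt => /predU1P[Q0|qmax0].
  rewrite -Q0 mulr0 !mul0r; apply: degenerate => A.
  have := gap_sqr_le q_ge0 rate_le mu0 mu_inv (ltW r0) rgap (meanA A).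
  by rewrite -/(var A) -Q0 mulr0 oppr0 mul0r pmulr_rle0.
set m := mu_min mu in mu_min_gt0 *.
have m1 : m <= 1.
  apply: le_trans (mu_min_le x0 mu_prob) _.
  by rewrite -mu1 /mass (bigD1 x0) ?inE//= lerDl sumr_ge0.
set z := 2 * eps * Num.sqrt m.
have s0 : 0 < Num.sqrt m by rewrite sqrtr_gt0.
have s1 : Num.sqrt m <= 1 by rewrite -sqrtr1 ler_wsqrtr.
have z0 : 0 < z by rewrite !mulr_gt0.
have z1 : z <= 1 by apply: le_trans (ler_wpM2l _ s1) _; lra.
set T := _ * ln _.
have T0 : 0 <= T.
  by rewrite !mulr_ge0 ?invr_ge0 ?ln_ge0 ?ler_pdivlMr ?mul1r// ltW.
apply: (t_mix_le x0) => // x A.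
apply: transition_dist_le => //; first exact: ltW.
have := @variance_decay R S q mu qmax r (fun y => (y \in A)%:R) T
  q_ge0 rate_le mu_prob mu_inv qmax0 (ltW r0) rgap T0.
rewrite /= -mass_indicator => decay; apply: le_trans decay _.
(* [T] was chosen so that the decay factor is exactly [z ^+ 2]. *)
have -> : expR (- (r ^+ 2 / qmax * T)) = z ^+ 2.
  have -> : - (r ^+ 2 / qmax * T) = ln z *+ 2.
    rewrite /T div1r lnV ?posrE// mulr2n; field.
    by rewrite !gt_eqF.
  by rewrite -lnXn// lnK// posrE exprn_gt0.
have -> : m * eps ^+ 2 = z ^+ 2 * (1 / 4).
  by rewrite /z exprMn sqr_sqrtr ?(ltW mu_min_gt0)//; field.
by rewrite ler_wpM2l ?sqr_ge0// indicator_variance_le.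
Qed.
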